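(* Let $\mathbb{K}$ be a field of characteristic zero, and let $A\subseteq T$ be Noetherian commutative $\mathbb{K}$-algebras such that $A$ is a direct summand of $T$ (as an $A$-module). Let $\underline f=f_1,\dots,f_\ell\in A$ and assume that $M^A[\underline f^{\underline s}]$ and $M^T[\underline f^{\underline s}]$ have $D_{A|\mathbb{K}}[\underline s]$- and $D_{T|\mathbb{K}}[\underline s]$-module structures, respectively, compatible with specialization. If $A\subseteq T$ is a differentially extensible inclusion, then the $D_{A|\mathbb{K}}[\underline s]$-module $M^A[\underline f^{\underline s}]$ is a differentially extensible summand of the $D_{T|\mathbb{K}}[\underline s]$-module $M^T[\underline f^{\underline s}]$.
   Context: For a commutative $\mathbb{K}$-algebra $B$, $D_{B|\mathbb{K}}$ is Grothendieck's ring of $\mathbb{K}$-linear differential operators; modules are left modules with action $\bullet$. For $f_1,\dots,f_\ell\in B$ and indeterminates $\underline s=s_1,\dots,s_\ell$, $M^B[\underline f^{\underline s}]=B_{f_1\cdots f_\ell}[\underline s]\,f_1^{s_1}\cdots f_\ell^{s_\ell}$ is the free rank-one $B_{f_1\cdots f_\ell}[\underline s]$-module on a formal symbol. For $t\in\mathbb{Z}^\ell$, $\varphi_t(h(\underline s)f_1^{s_1}\cdots f_\ell^{s_\ell})=h(t)f_1^{t_1}\cdots f_\ell^{t_\ell}\in B_{f_1\cdots f_\ell}$. A $D_{B|\mathbb{K}}[\underline s]$-module structure on $M^B[\underline f^{\underline s}]$ is compatible with specialization if $\varphi_t(\delta\bullet v)=\delta(t)\bullet\varphi_t(v)$ for all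 $v$, $\delta\in D_{B|\mathbb{K}}[\underline s]$, $t\in\mathbb{Z}^\ell$ (where $B_{f_1\cdots f_\ell}$ has its usual $D_{B|\mathbb{K}}$-structure by unique extension of operators to the localization); such a structure is unique if it exists. The inclusion $A\subseteq T$ is differentially extensible if for every $\delta\in D_{A|\mathbb{K}}$ there is $\widetilde\delta\in D_{T|\mathbb{K}}$ extending it, i.e. $\widetilde\delta|_A=\delta$. An element of $D_{T|\mathbb{K}}[\underline s]$ extends an element of $D_{A|\mathbb{K}}[\underline s]$ if each coefficient extends the corresponding coefficient. Let $\beta:T\to A$ be an $A$-linear splitting. For $\delta\in D_{T|\mathbb{K}}[\underline s]$, $\beta\circ\delta|_A\in D_{A|\mathbb{K}}[\underline s]$ is formed coefficientwise. A $D_{A|\mathbb{K}}[\underline s]$-module $M$ is a differentially extensible summand of a $D_{T|\mathbb{K}}[\underline s]$-module $N$ if: (1) it is a differential direct summand, i.e. $M\subseteq N$ and there is an $A$-linear splitting $\Theta:N\to M$ with $\Theta(\delta\bullet v)=(\beta\circ\delta|_A)\bullet v$ for all $\delta\in D_{T|\mathbb{K}}[\underline s]$, $v\in M$; and (2) for any $\delta\in D_{A|\mathbb{K}}[\underline s]$ and any $\widetilde\delta\in D_{T|\mathbb{K}}[\underline s]$ extending $\delta$, $\widetilde\delta\bullet m=\delta\bullet m$ for all $m\in M$. *)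

(* Defs.v *)
From HB Require Import structures.
From mathcomp Require Import all_boot all_algebra generic_quotient.
From mathcomp Require Import ring.
From mathcomp Require Import finmap.
From mathcomp Require Import boolp.
From mathcomp.multinomials Require Import monalg.

Set Implicit Arguments.
Unset Strict Implicit.
Unset Printing Implicit Defensive.

Import GRing.Theory.

Local Open Scope ring_scope.

Definition noetherian (R : comPzRingType) : Prop :=
  forall I : R -> Prop,
    I 0 -> (forall x y, I x -> I y -> I (x + y)) ->
    (forall a x, I x -> I (a * x)) ->
  exists s : seq R, forall x,
    I x <-> exists c : 'I_(size s) -> R, x = \sum_(i < size s) c i * s`_i.

(* Localizations are built over [comPzRingType], not over a type of K-algebras,
   because B_f is the zero ring when f is nilpotent, while MathComp's
   K-algebras are nonzero. *)
Section Localization.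
Variables (R : comPzRingType) (f : R).

(* The pair (a, n) stands for a / f ^ n. *)
Definition loc_rel : rel (R * nat) := fun x y =>
  `[< exists k, f ^+ k * (x.1 * f ^+ y.2) = f ^+ k * (y.1 * f ^+ x.2) >].

Lemma loc_relP x y : reflect
  (exists k, f ^+ k * (x.1 * f ^+ y.2) = f ^+ k * (y.1 * f ^+ x.2))
  (loc_rel x y).
Proof. exact: asboolP. Qed.

Lemma loc_rel_refl : reflexive loc_rel.
Proof. by move=> x; apply/loc_relP; exists 0%N. Qed.

Lemma loc_rel_sym : symmetric loc_rel.
Proof. by move=> x y; apply/loc_relP/loc_relP => -[k e]; exists k. Qed.

Lemma loc_rel_trans : transitive loc_rel.
Proof.
move=> [b m] [a n] [c p] /loc_relP[k /= e1] /loc_relP[l /= e2].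
apply/loc_relP; exists (k + l + m)%N => /=.
transitivity (f ^+ l * f ^+ p * (f ^+ k * (a * f ^+ m))).
  by rewrite !exprD; ring.
rewrite e1; transitivity (f ^+ k * f ^+ n * (f ^+ l * (b * f ^+ p))); first ring.
by rewrite e2 !exprD; ring.
Qed.

Canonical loc_equiv := EquivRel loc_rel loc_rel_refl loc_rel_sym loc_rel_trans.

Definition loc : Type := {eq_quot loc_equiv}%qT.
HB.instance Definition _ := Choice.on loc.
HB.instance Definition _ := EqQuotient.on loc.

Definition frac (a : R) (n : nat) : loc := \pi_loc%qT (a, n).

Lemma fracP (a b : R) n m : frac a n = frac b m <->
  exists k, f ^+ k * (a * f ^+ m) = f ^+ k * (b * f ^+ n).
Proof.
split; first by move/eqmodP/loc_relP.
by move=> h; apply/eqmodP/loc_relP.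
Qed.

Definition num (x : loc) : R := (repr x).1.
Definition den (x : loc) : nat := (repr x).2.

Lemma frac_repr x : frac (num x) (den x) = x.
Proof. by rewrite /frac /num /den -surjective_pairing reprK. Qed.

Lemma loc_ind (P : loc -> Prop) : (forall a n, P (frac a n)) -> forall x, P x.
Proof. by move=> h x; rewrite -(frac_repr x). Qed.

Definition loc_add (x y : loc) : loc :=
  frac (num x * f ^+ den y + num y * f ^+ den x) (den x + den y).
Definition loc_opp (x : loc) : loc := frac (- num x) (den x).
Definition loc_mul (x y : loc) : loc := frac (num x * num y) (den x + den y).

Lemma num_den a n :
  exists k, f ^+ k * (num (frac a n) * f ^+ n)
          = f ^+ k * (a * f ^+ den (frac a n)).
Proof. by apply/fracP; rewrite frac_repr. Qed.

Lemma loc_addE a b n m :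
  loc_add (frac a n) (frac b m) = frac (a * f ^+ m + b * f ^+ n) (n + m).
Proof.
rewrite /loc_add; have [k ek] := num_den a n; have [l el] := num_den b m.
move: (num _) (den _) ek (num _) (den _) el => a' n' ek b' m' el.
apply/fracP; exists (k + l)%N; rewrite !exprD.
transitivity (f ^+ l * f ^+ m * f ^+ m' * (f ^+ k * (a' * f ^+ n))
  + f ^+ k * f ^+ n * f ^+ n' * (f ^+ l * (b' * f ^+ m))); first ring.
by rewrite ek el; ring.
Qed.

Lemma loc_oppE a n : loc_opp (frac a n) = frac (- a) n.
Proof.
rewrite /loc_opp; have [k ek] := num_den a n.
apply/fracP; exists k; rewrite !mulNr !mulrN; congr (- _); exact: ek.
Qed.

Lemma loc_mulE a b n m :
  loc_mul (frac a n) (frac b m) = frac (a * b) (n + m).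
Proof.
rewrite /loc_mul; have [k ek] := num_den a n; have [l el] := num_den b m.
move: (num _) (den _) ek (num _) (den _) el => a' n' ek b' m' el.
apply/fracP; exists (k + l)%N; rewrite !exprD.
transitivity ((f ^+ k * (a' * f ^+ n)) * (f ^+ l * (b' * f ^+ m))); first ring.
by rewrite ek el; ring.
Qed.

Lemma loc_addA : associative loc_add.
Proof.
elim/loc_ind=> a n; elim/loc_ind=> b m; elim/loc_ind=> c p.
by rewrite !loc_addE; apply/fracP; exists 0%N; rewrite !exprD; ring.
Qed.

Lemma loc_addC : commutative loc_add.
Proof.
elim/loc_ind=> a n; elim/loc_ind=> b m.
by rewrite !loc_addE addnC addrC.
Qed.

Lemma loc_add0 : left_id (frac 0 0) loc_add.
Proof.
by elim/loc_ind=> a n; rewrite loc_addE mul0r add0r expr0 mulr1 add0n.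
Qed.

Lemma loc_addN : left_inverse (frac 0 0) loc_opp loc_add.
Proof.
elim/loc_ind=> a n; rewrite loc_oppE loc_addE; apply/fracP; exists 0%N.
by rewrite !exprD; ring.
Qed.

HB.instance Definition _ :=
  GRing.isZmodule.Build loc loc_addA loc_addC loc_add0 loc_addN.

Lemma loc_mulA : associative loc_mul.
Proof.
elim/loc_ind=> a n; elim/loc_ind=> b m; elim/loc_ind=> c p.
by rewrite !loc_mulE mulrA addnA.
Qed.

Lemma loc_mulC : commutative loc_mul.
Proof.
elim/loc_ind=> a n; elim/loc_ind=> b m.
by rewrite !loc_mulE mulrC addnC.
Qed.

Lemma loc_mul1 : left_id (frac 1 0) loc_mul.
Proof. by elim/loc_ind=> a n; rewrite loc_mulE mul1r add0n. Qed.

Lemma loc_mulDl : left_distributive loc_mul loc_add.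
Proof.
elim/loc_ind=> a n; elim/loc_ind=> b m; elim/loc_ind=> c p.
rewrite loc_addE !loc_mulE loc_addE; apply/fracP; exists 0%N.
by rewrite !exprD; ring.
Qed.

HB.instance Definition _ :=
  GRing.Zmodule_isComPzRing.Build loc loc_mulA loc_mulC loc_mul1 loc_mulDl.

Definition loc_of (a : R) : loc := frac a 0.

Lemma fracD a b n m :
  frac a n + frac b m = frac (a * f ^+ m + b * f ^+ n) (n + m).
Proof. exact: loc_addE. Qed.

Lemma fracM a b n m : frac a n * frac b m = frac (a * b) (n + m).
Proof. exact: loc_mulE. Qed.

Lemma loc_of_is_additive : zmod_morphism loc_of.
Proof.
move=> a b; rewrite /loc_of [- frac b 0]loc_oppE fracD.
by rewrite expr0 !mulr1.
Qed.

Lemma loc_of_is_multiplicative : monoid_morphism loc_of.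
Proof. by split=> // a b; rewrite /loc_of fracM. Qed.

HB.instance Definition _ :=
  GRing.isZmodMorphism.Build R loc loc_of loc_of_is_additive.
HB.instance Definition _ :=
  GRing.isMonoidMorphism.Build R loc loc_of loc_of_is_multiplicative.

Lemma frac_cancel a n : frac (f ^+ n * a) n = loc_of a.
Proof. by apply/fracP; exists 0%N; rewrite !expr0; ring. Qed.

Lemma loc_of_frac a n : loc_of f ^+ n * frac a n = loc_of a.
Proof. by rewrite -rmorphXn fracM frac_cancel. Qed.

Lemma loc_ofX_inj n : injective (fun x => loc_of f ^+ n * x).
Proof.
move=> x y /= e; have e1 : frac 1 n * loc_of f ^+ n = 1.
  by rewrite -rmorphXn fracM addn0; apply/fracP; exists 0%N; rewrite !expr0; ring.
by rewrite -[x]mul1r -[y]mul1r -e1 -!mulrA e.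
Qed.

End Localization.

Arguments loc_of {R} f a.

(* a / f ^ n |-> h a / g ^ n, a well-defined ring morphism when h f = g. *)
Definition loc_map (R S : comPzRingType) (h : R -> S) (f : R) (g : S)
  (x : loc f) : loc g := frac g (h (num x)) (den x).
Arguments loc_map {R S} h {f} g x.

Lemma loc_mapE (R S : comPzRingType) (h : {rmorphism R -> S}) (f : R) (a : R) n :
  loc_map h (h f) (frac f a n) = frac (h f) (h a) n.
Proof.
apply/fracP; have [k ek] := num_den f a n; exists k.
by rewrite -!rmorphXn -!rmorphM ek.
Qed.

Lemma loc_of_unitE (R : comPzRingType) (f : R) (x : loc f) :
  loc_of f f ^+ den x * x = loc_of f (num x).
Proof. by rewrite -{2}(frac_repr x) loc_of_frac. Qed.

Lemma loc_ofX (R : comPzRingType) (f a : R) n :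
  loc_of f (a ^+ n) = loc_of f a ^+ n.
Proof. exact: rmorphXn. Qed.

Lemma loc_of_unit (R : comPzRingType) (f : R) (x : loc f) :
  loc_of f (f ^+ den x) * x = loc_of f (num x).
Proof. by rewrite loc_ofX loc_of_unitE. Qed.

(* Grothendieck's differential operators on a commutative ring R, relative to
   the scalars e : K -> R: operators of order at most 0 are the R-linear maps,
   and d has order at most n.+1 when every [d, b] has order at most n. *)
Definition bracket (R : comPzRingType) (d : R -> R) (b : R) : R -> R :=
  fun x => d (b * x) - b * d x.

Fixpoint diffop_order (R : comPzRingType) (n : nat) (d : R -> R) : Prop :=
  if n is n'.+1 then forall b, diffop_order n' (bracket d b)
  else forall b x, d (b * x) = b * d x.

Definition is_diffop (K : pzRingType) (R : comPzRingType) (e : K -> R)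
    (d : R -> R) : Prop :=
  [/\ forall x y, d (x + y) = d x + d y,
      forall k x, d (e k * x) = e k * d x
    & exists n, diffop_order n d].

Section DiffOpTheory.
Variables (R : comPzRingType).
Implicit Types (d : R -> R) (b : R).

Lemma diffop_order_ext n d1 d2 :
  d1 =1 d2 -> diffop_order n d1 -> diffop_order n d2.
Proof. by move/funext ->. Qed.

Lemma diffop_order0 n : diffop_order n (fun=> 0 : R).
Proof.
elim: n => [|n IH] /= b; first by rewrite mulr0.
by apply: diffop_order_ext IH => x; rewrite /bracket mulr0 subr0.
Qed.

Lemma diffop_orderS n d : diffop_order n d -> diffop_order n.+1 d.
Proof.
elim: n d => [|n IH] d hd b; last exact/IH/hd.
apply: (diffop_order_ext _ (diffop_order0 0)) => x.
by rewrite /bracket hd subrr.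
Qed.

Lemma diffop_orderW n m d : (n <= m)%N -> diffop_order n d -> diffop_order m d.
Proof.
move=> /subnK <-; elim: (m - n)%N => // p IH /IH.
by rewrite addSn; apply: diffop_orderS.
Qed.

Lemma diffop_orderD n d1 d2 : diffop_order n d1 -> diffop_order n d2 ->
  diffop_order n (fun x => d1 x + d2 x).
Proof.
elim: n d1 d2 => [|n IH] d1 d2 h1 h2 b.
  by move=> x; rewrite h1 h2 mulrDr.
apply: diffop_order_ext (IH _ _ (h1 b) (h2 b)) => x.
by rewrite /bracket; ring.
Qed.

Lemma diffop_orderN n d : diffop_order n d -> diffop_order n (fun x => - d x).
Proof.
elim: n d => [|n IH] d h b; first by move=> x; rewrite h mulrN.
by apply: diffop_order_ext (IH _ (h b)) => x; rewrite /bracket; ring.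
Qed.

Lemma diffop_order_comp n m d1 d2 :
  (forall x y, d1 (x + y) = d1 x + d1 y) ->
  (forall x y, d2 (x + y) = d2 x + d2 y) ->
  diffop_order n d1 -> diffop_order m d2 ->
  diffop_order (n + m) (fun x => d1 (d2 x)).
Proof.
move: {2}(n + m)%N (leqnn (n + m)) => p.
elim: p n m d1 d2 => [|p IH] n m d1 d2.
  rewrite leqn0 addn_eq0 => /andP[/eqP-> /eqP->] _ _ h1 h2 b x.
  by rewrite h2 h1.
have brD d b : (forall x y, d (x + y) = d x + d y) ->
    forall x y, bracket d b (x + y) = bracket d b x + bracket d b y.
  by move=> dD x y; rewrite /bracket mulrDr !dD; ring.
move=> le D1 D2 h1 h2.
have B1 x y : d1 (x - y) = d1 x - d1 y.
  by apply: (addIr (d1 y)); rewrite -D1 !subrK.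
have brE b : bracket (fun x => d1 (d2 x)) b
    =1 (fun x => d1 (bracket d2 b x) + bracket d1 b (d2 x)).
  by move=> x; rewrite /bracket B1; ring.
case: n m h1 h2 le => [|n] [|m] h1 h2 le.
- by move=> b x; rewrite h2 h1.
- move=> b; apply: diffop_order_ext (IH 0%N m _ _ le D1 (brD _ b D2) h1 (h2 b)).
  by move=> x; rewrite /bracket B1 h1.
- rewrite addn0 in le *; move=> b.
  have := IH n 0%N _ _ _ (brD _ b D1) D2 (h1 b) h2.
  rewrite addn0 => /(_ le); apply: diffop_order_ext => x.
  rewrite brE [X in d1 X]/bracket h2 subrr.
  have -> : d1 0 = 0 by apply: (addIr (d1 0)); rewrite -D1 !add0r.
  by rewrite add0r.
- move=> b; apply: (diffop_order_ext (fsym (brE b))).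
  apply: diffop_orderD; last first.
    exact: (IH n m.+1 _ _ le (brD _ b D1) D2 (h1 b) h2).
  have -> : (n + m.+1 = n.+1 + m)%N by rewrite addnS addSn.
  apply: (IH n.+1 m _ _ _ D1 (brD _ b D2) h1 (h2 b)).
  by rewrite addSn -addnS.
Qed.

End DiffOpTheory.

Section LocExtension.
Variables (R : comPzRingType) (f : R).
Local Notation L := (loc f).
Local Notation lam := (loc_of f).

Definition fin_order (S : comPzRingType) (d : S -> S) : Prop :=
  (forall x y, d (x + y) = d x + d y) /\ exists n, diffop_order n d.

Section Closure.
Variable S : comPzRingType.
Implicit Types d : S -> S.

Lemma fin_order_mul (y : S) : fin_order (fun x => y * x).
Proof.
split; first by move=> x z; rewrite mulrDr.
by exists 0%N => b x /=; ring.
Qed.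

Lemma fin_orderD d1 d2 :
  fin_order d1 -> fin_order d2 -> fin_order (fun x => d1 x + d2 x).
Proof.
move=> [D1 [n h1]] [D2 [m h2]]; split; first by move=> x y; rewrite D1 D2; ring.
exists (maxn n m); apply: diffop_orderD.
  exact: diffop_orderW (leq_maxl _ _) h1.
exact: diffop_orderW (leq_maxr _ _) h2.
Qed.

Lemma fin_orderN d : fin_order d -> fin_order (fun x => - d x).
Proof.
move=> [D [n h]]; split; first by move=> x y; rewrite D; ring.
by exists n; apply: diffop_orderN.
Qed.

Lemma fin_order_comp d1 d2 :
  fin_order d1 -> fin_order d2 -> fin_order (fun x => d1 (d2 x)).
Proof.
move=> [D1 [n h1]] [D2 [m h2]]; split; first by move=> x y; rewrite D2 D1.
by exists (n + m)%N; apply: diffop_order_comp.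
Qed.

Lemma add_fun0 d : (forall x y, d (x + y) = d x + d y) -> d 0 = 0.
Proof. by move=> D; apply: (addIr (d 0)); rewrite -D !add0r. Qed.

Lemma add_funB d : (forall x y, d (x + y) = d x + d y) ->
  forall x y, d (x - y) = d x - d y.
Proof. by move=> D x y; apply: (addIr (d y)); rewrite -D !subrK. Qed.

End Closure.

Lemma loc_op_eq0 (d : L -> L) : fin_order d ->
  (forall a, d (lam a) = 0) -> forall x, d x = 0.
Proof.
move=> [D [n h]] d0.
suff dl b x : d (lam b * x) = lam b * d x.
  move=> x; apply: (@loc_ofX_inj _ f (den x)) => /=.
  by rewrite -loc_ofX -dl loc_of_unit d0 mulr0.
elim: n d D h d0 b x => [|n IH] d D h d0 b x; first exact: h.
apply/eqP; rewrite -subr_eq0; apply/eqP.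
have BD y z : bracket d (lam b) (y + z)
    = bracket d (lam b) y + bracket d (lam b) z.
  by rewrite /bracket mulrDr !D; ring.
have B0 a : bracket d (lam b) (lam a) = 0.
  by rewrite /bracket -rmorphM !d0 mulr0 subrr.
have Bl := IH _ BD (h (lam b)) B0.
rewrite -[_ - _]/(bracket d (lam b) x).
apply: (@loc_ofX_inj _ f (den x)) => /=.
by rewrite -loc_ofX -Bl loc_of_unit B0 mulr0.
Qed.

Lemma loc_op_uniq (d1 d2 : L -> L) : fin_order d1 -> fin_order d2 ->
  (forall a, d1 (lam a) = d2 (lam a)) -> forall x, d1 x = d2 x.
Proof.
move=> h1 h2 e x; apply/eqP; rewrite -subr_eq0; apply/eqP.
apply: (@loc_op_eq0 (fun x => d1 x - d2 x)).
  by apply: fin_orderD => //; apply: fin_orderN.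
by move=> a; rewrite e subrr.
Qed.

Variables (K : pzRingType) (e : K -> R).

Definition loc_ext_spec n (d : R -> R) (d' : L -> L) : Prop :=
  [/\ forall x y, d' (x + y) = d' x + d' y,
      forall k x, d' (lam (e k) * x) = lam (e k) * d' x,
      diffop_order n d'
    & forall a, d' (lam a) = lam (d a)].

Lemma loc_ext_step n (d : R -> R) (E : R -> L -> L) :
  (forall x y, d (x + y) = d x + d y) ->
  (forall k x, d (e k * x) = e k * d x) ->
  (forall b, loc_ext_spec n (bracket d b) (E b)) ->
  exists d', loc_ext_spec n.+1 d d'.
Proof.
move=> dD dK hE; pose F := lam f.
have ED b x y : E b (x + y) = E b x + E b y by case: (hE b).
have EK b k x : E b (lam (e k) * x) = lam (e k) * E b x by case: (hE b).
have Eo b : diffop_order n (E b) by case: (hE b).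
have Ee b a : E b (lam a) = lam (d (b * a) - b * d a) by case: (hE b).
have Ef b : fin_order (E b) by split=> //; exists n.
have EM b c y : E (b * c) y = E b (lam c * y) + lam b * E c y.
  apply: (@loc_op_uniq (E (b * c)) (fun y => E b (lam c * y) + lam b * E c y)).
  - exact: Ef.
  - apply: fin_orderD.
      exact: (fin_order_comp (Ef b) (fin_order_mul (lam c))).
    exact: (fin_order_comp (fin_order_mul (lam b)) (Ef c)).
  - move=> a; rewrite -rmorphM !Ee -rmorphM -rmorphD; congr (lam _).
    by rewrite -mulrA; ring.
have ld0 u : lam u = 0 -> lam (d u) = 0.
  move=> u0; have [k] : exists k, f ^+ k * (u * f ^+ 0) = f ^+ k * (0 * f ^+ 0).
    exact/fracP.
  rewrite expr0 mul0r mulr1 mulr0 => fu; apply: (@loc_ofX_inj _ f k) => /=.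
  have := Ee (f ^+ k) u; rewrite u0 (add_fun0 (ED _)) fu (add_fun0 dD) add0r.
  rewrite rmorphN /= rmorphM /= loc_ofX => /esym/eqP; rewrite oppr_eq0 => /eqP ->.
  by rewrite mulr0.
have lde u v : lam u = lam v -> lam (d u) = lam (d v).
  move=> uv; apply/eqP; rewrite -subr_eq0 -rmorphB -(add_funB dD); apply/eqP.
  by apply: ld0; rewrite rmorphB /= uv subrr.
have Z x p m b : F ^+ m * x = lam b ->
    F ^+ p * (lam (d b) - E (f ^+ m) x)
    = lam (d (f ^+ p * b)) - E (f ^+ p * f ^+ m) x.
  move=> xb; rewrite EM [lam (f ^+ m)]loc_ofX xb Ee rmorphB /= rmorphM /= loc_ofX /F.
  by ring.
have F1 m : F ^+ m * frac f 1 m = 1 by rewrite /F loc_of_frac.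
pose d' x := frac f 1 (den x) * (lam (d (num x)) - E (f ^+ den x) x).
have key x m b : F ^+ m * x = lam b ->
    F ^+ m * d' x = lam (d b) - E (f ^+ m) x.
  move=> xb; apply: (@loc_ofX_inj _ f (den x)) => /=; rewrite -/F.
  have xc := loc_of_unitE x; rewrite -/F in xc.
  rewrite (Z _ _ _ _ xb) mulrCA /d' [F ^+ den x * (_ * _)]mulrA F1 mul1r.
  rewrite (Z _ _ _ _ xc) [f ^+ m * f ^+ _]mulrC; congr (_ - _); apply: lde.
  by rewrite !rmorphM /= !loc_ofX -/F -xb -xc; ring.
have d'D x y : d' (x + y) = d' x + d' y.
  have hx : F ^+ (den x + den y) * x = lam (f ^+ den y * num x).
    by rewrite rmorphM /= loc_ofX -loc_of_unitE exprD /F; ring.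
  have hy : F ^+ (den x + den y) * y = lam (f ^+ den x * num y).
    by rewrite rmorphM /= loc_ofX -loc_of_unitE exprD /F; ring.
  have hxy : F ^+ (den x + den y) * (x + y)
      = lam (f ^+ den y * num x + f ^+ den x * num y).
    by rewrite mulrDr hx hy -rmorphD.
  apply: (@loc_ofX_inj _ f (den x + den y)) => /=; rewrite -/F mulrDr.
  rewrite (key _ _ _ hx) (key _ _ _ hy) (key _ _ _ hxy) dD ED rmorphD /=.
  by ring.
have d'K k x : d' (lam (e k) * x) = lam (e k) * d' x.
  have hx := loc_of_unitE x; rewrite -/F in hx.
  have hy : F ^+ den x * (lam (e k) * x) = lam (e k * num x).
    by rewrite rmorphM /= -hx; ring.
  apply: (@loc_ofX_inj _ f (den x)) => /=; rewrite -/F.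
  rewrite (key _ _ _ hy) mulrCA (key _ _ _ hx) EK dK rmorphM /=.
  by ring.
have d'e a : d' (lam a) = lam (d a).
  have ha : F ^+ 0 * lam a = lam a by rewrite expr0 mul1r.
  have := key _ _ _ ha; rewrite !expr0 !mul1r Ee !mul1r subrr rmorph0 /= subr0.
  by [].
have d'l b x : d' (lam b * x) = lam b * d' x + E b x.
  have hx := loc_of_unitE x; rewrite -/F in hx.
  have hy : F ^+ den x * (lam b * x) = lam (b * num x).
    by rewrite rmorphM /= -hx; ring.
  apply: (@loc_ofX_inj _ f (den x)) => /=; rewrite -/F.
  rewrite (key _ _ _ hy) mulrDr mulrCA (key _ _ _ hx).
  have := EM b (f ^+ den x) x; rewrite mulrC EM loc_ofX -/F hx Ee.
  rewrite rmorphB /= !rmorphM /= => /(canRL (addrK _)) ->.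
  by ring.
exists d'; split=> // y.
have hy := loc_of_unitE y; rewrite -/F in hy.
set m := den y in hy; set b := num y in hy.
have bE x : bracket d' y x = frac f 1 m * (E b x - E (f ^+ m) (y * x)).
  apply: (@loc_ofX_inj _ f m) => /=; rewrite -/F mulrA F1 mul1r /bracket mulrBr.
  have := d'l (f ^+ m) (y * x); rewrite loc_ofX -/F mulrA hy d'l.
  rewrite [F ^+ m * (y * _)]mulrA hy => e1.
  by apply: (addIr (E (f ^+ m) (y * x))); rewrite addrAC -e1; ring.
apply: (diffop_order_ext (fsym bE)).
have [mD [_ _]] := fin_order_mul (frac f 1 m).
rewrite -[n]add0n; apply: (@diffop_order_comp _ 0 n (fun x => frac f 1 m * x)
  (fun x => E b x - E (f ^+ m) (y * x))) => //.
- by move=> x z; rewrite mulrDr !ED; ring.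
- by move=> c x /=; ring.
apply: diffop_orderD; first exact: Eo.
apply: diffop_orderN; rewrite -[n]addn0.
apply: (@diffop_order_comp _ n 0 (E (f ^+ m)) (fun x => y * x)) => //.
- by move=> x z; rewrite mulrDr.
- by move=> c x /=; ring.
Qed.

Lemma loc_ext_exists n (d : R -> R) :
  (forall x y, d (x + y) = d x + d y) ->
  (forall k x, d (e k * x) = e k * d x) ->
  diffop_order n d -> exists d', loc_ext_spec n d d'.
Proof.
elim: n d => [|n IH] d dD dK h.
  exists (fun x => lam (d 1) * x); split.
  - by move=> x y; rewrite mulrDr.
  - by move=> k x; rewrite mulrCA.
  - by move=> b x; rewrite mulrCA.
  by move=> a; rewrite -rmorphM -{2}[a]mulr1 h mulrC.
have hE b : exists d', loc_ext_spec n (bracket d b) d'.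
  apply: IH; last exact: h.
    by move=> x y; rewrite /bracket mulrDr !dD; ring.
  by move=> k x; rewrite /bracket mulrCA !dK; ring.
exact: (loc_ext_step dD dK (fun b => svalP (cid (hE b)))).
Qed.

Lemma loc_diffop_exists (d : R -> R) : is_diffop e d ->
  exists d' : L -> L, is_diffop (lam \o e) d' /\ forall a, d' (lam a) = lam (d a).
Proof.
move=> [dD dK [n dn]]; have [d' [hD hK hn he]] := loc_ext_exists dD dK dn.
by exists d'; split=> //; split=> //; exists n.
Qed.

Lemma loc_diffop_unique (d1 d2 : L -> L) :
  is_diffop (lam \o e) d1 -> is_diffop (lam \o e) d2 ->
  (forall a, d1 (lam a) = d2 (lam a)) -> d1 = d2.
Proof.
move=> [D1 _ n1] [D2 _ n2] h; apply/funext/loc_op_uniq => //; by split.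
Qed.

End LocExtension.

Section DiffOpRing.
Variables (K : fieldType) (B : comAlgType K).

Record diffop := DiffOp {
  diffop_fun :> B -> B;
  diffop_subproof : `[< is_diffop (in_alg B) diffop_fun >]
}.

HB.instance Definition _ := [isSub for diffop_fun].
HB.instance Definition _ := [Choice of diffop by <:].

Implicit Types d : diffop.

Lemma diffopP d : is_diffop (in_alg B) d.
Proof. exact/asboolP/diffop_subproof. Qed.

Lemma diffopD d x y : d (x + y) = d x + d y.
Proof. by case: (diffopP d). Qed.

Lemma diffop_ext d1 d2 : (forall x, d1 x = d2 x) -> d1 = d2.
Proof. by move=> h; apply/val_inj/funext. Qed.

Lemma diffop_fin_order d : fin_order d.
Proof. by case: (diffopP d). Qed.

Lemma diffop_of_fin (g : B -> B) : fin_order g ->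
  (forall k x, g (in_alg B k * x) = in_alg B k * g x) ->
  `[< is_diffop (in_alg B) g >].
Proof. by move=> [gD gn] gK; apply/asboolP. Qed.

Lemma diffop0_subproof : `[< is_diffop (in_alg B) (fun=> 0) >].
Proof.
apply: diffop_of_fin => [|k x]; last by rewrite mulr0.
by split=> [x y|]; [rewrite addr0 | exists 0%N; apply: diffop_order0].
Qed.

Lemma diffopN_subproof d : `[< is_diffop (in_alg B) (fun x => - d x) >].
Proof.
apply: diffop_of_fin; first exact/fin_orderN/diffop_fin_order.
by move=> k x; case: (diffopP d) => _ -> _; rewrite mulrN.
Qed.

Lemma diffopD_subproof d1 d2 :
  `[< is_diffop (in_alg B) (fun x => d1 x + d2 x) >].
Proof.
apply: diffop_of_fin; first by apply: fin_orderD; apply: diffop_fin_order.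
move=> k x; case: (diffopP d1) => _ -> _; case: (diffopP d2) => _ -> _.
by rewrite mulrDr.
Qed.

Lemma diffopM_subproof d1 d2 : `[< is_diffop (in_alg B) (fun x => d1 (d2 x)) >].
Proof.
apply: diffop_of_fin.
  exact: (fin_order_comp (diffop_fin_order d1) (diffop_fin_order d2)).
by move=> k x; case: (diffopP d2) => _ -> _; case: (diffopP d1) => _ -> _.
Qed.

Lemma mul_op_subproof (b : B) : `[< is_diffop (in_alg B) (fun x => b * x) >].
Proof.
apply: diffop_of_fin; first exact: fin_order_mul.
by move=> k x; rewrite mulrCA.
Qed.

(* The operator of multiplication by b, i.e. b viewed in D_B. *)
Definition mul_op (b : B) : diffop := DiffOp (mul_op_subproof b).

Definition diffop_zero : diffop := DiffOp diffop0_subproof.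
Definition diffop_opp d : diffop := DiffOp (diffopN_subproof d).
Definition diffop_add d1 d2 : diffop := DiffOp (diffopD_subproof d1 d2).
Definition diffop_mul d1 d2 : diffop := DiffOp (diffopM_subproof d1 d2).

Lemma diffop_addA : associative diffop_add.
Proof. by move=> d1 d2 d3; apply: diffop_ext => x /=; rewrite addrA. Qed.
Lemma diffop_addC : commutative diffop_add.
Proof. by move=> d1 d2; apply: diffop_ext => x /=; rewrite addrC. Qed.
Lemma diffop_add0 : left_id diffop_zero diffop_add.
Proof. by move=> d; apply: diffop_ext => x /=; rewrite add0r. Qed.
Lemma diffop_addN : left_inverse diffop_zero diffop_opp diffop_add.
Proof. by move=> d; apply: diffop_ext => x /=; rewrite addNr. Qed.

HB.instance Definition _ := GRing.isZmodule.Build diffop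
  diffop_addA diffop_addC diffop_add0 diffop_addN.

Lemma diffop_mulA : associative diffop_mul.
Proof. by move=> d1 d2 d3; apply: diffop_ext. Qed.
Lemma diffop_mul1 : left_id (mul_op 1) diffop_mul.
Proof. by move=> d; apply: diffop_ext => x /=; rewrite mul1r. Qed.
Lemma diffop_mulr1 : right_id (mul_op 1) diffop_mul.
Proof. by move=> d; apply: diffop_ext => x /=; rewrite mul1r. Qed.
Lemma diffop_mulDl : left_distributive diffop_mul diffop_add.
Proof. by move=> d1 d2 d3; apply: diffop_ext. Qed.
Lemma diffop_mulDr : right_distributive diffop_mul diffop_add.
Proof. by move=> d1 d2 d3; apply: diffop_ext => x /=; rewrite diffopD. Qed.
Lemma diffop_one_neq0 : mul_op 1 != 0 :> diffop.
Proof.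
apply/eqP => /(congr1 (fun d : diffop => d 1)) /= /eqP.
by rewrite mulr1 oner_eq0.
Qed.

HB.instance Definition _ := GRing.Zmodule_isNzRing.Build diffop
  diffop_mulA diffop_mul1 diffop_mulr1 diffop_mulDl diffop_mulDr
  diffop_one_neq0.

(* The usual action of D_B on B_f: the unique operator on B_f extending d. *)
Definition loc_op (f : B) (d : diffop) : loc f -> loc f :=
  sval (cid (@loc_diffop_exists B f K (in_alg B) d (diffopP d))).

Arguments loc_op f d x : clear implicits.

Lemma loc_opP (f : B) (d : diffop) :
  is_diffop (loc_of f \o in_alg B) (loc_op f d) /\
  forall a, loc_op f d (loc_of f a) = loc_of f (d a).
Proof. exact: svalP (cid (@loc_diffop_exists B f K (in_alg B) d (diffopP d))). Qed.

End DiffOpRing.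

Arguments loc_op {K B} f d x.

(* [{mpoly G[l]}] is multinomials' type of finitely supported families of
   coefficients in an additive group G: G[s_1, ..., s_l], which is a ring, with
   central variables, when G is one. *)
Section Coefficients.
Variable l : nat.

(* h(t); G need not be a ring, since t is integral. *)
Definition specialize (G : zmodType) (t : 'I_l -> int) (h : {mpoly G[l]}) : G :=
  \sum_(m <- msupp h) h@_m *~ (\prod_(i < l) t i ^+ m i).

Definition map_coef (G H : zmodType) (g : G -> H) (h : {mpoly G[l]}) : {mpoly H[l]} :=
  [malg m in msupp h => g h@_m].

Lemma map_coefE (G H : zmodType) (g : G -> H) (h : {mpoly G[l]}) m :
  g 0 = 0 -> (map_coef g h)@_m = g h@_m.
Proof. by move=> g0; rewrite mcoeffE; case: msuppP. Qed.
End Coefficients.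

(* The structure is put on a given group V, so it is not an [lmodType]. *)
Record module_structure (R : pzRingType) (V : zmodType) := ModuleStructure {
  act :> R -> V -> V;
  act_addr : forall a v w, act a (v + w) = act a v + act a w;
  act_addl : forall a b v, act (a + b) v = act a v + act b v;
  act_mul : forall a b v, act (a * b) v = act a (act b v);
  act_one : forall v, act 1 v = v
}.

Section Specialization.
Variables (K : fieldType) (B : comAlgType K) (l : nat) (fs : 'I_l -> B).
Local Notation f := (\prod_(i < l) fs i).

(* M^B[f^s]: the polynomial h stands for h(s) f_1^{s_1} ... f_l^{s_l}. *)
Definition Mfs : zmodType := {mpoly (loc f)[l]}.

(* 1 / f_i in the localization at f = f_1 ... f_l. *)
Definition loc_inv (i : 'I_l) : loc f := frac f (\prod_(j < l | j != i) fs j) 1.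

Lemma loc_invP i : loc_of f (fs i) * loc_inv i = 1.
Proof.
rewrite /loc_of /loc_inv fracM add0n.
have <- : f = fs i * \prod_(j < l | j != i) fs j by exact: bigD1.
by have := frac_cancel f 1 1; rewrite expr1 mulr1.
Qed.

Definition f_pow (t : 'I_l -> int) : loc f :=
  \prod_(i < l) match t i with
                | Posz n => loc_of f (fs i) ^+ n
                | Negz n => loc_inv i ^+ n.+1
                end.

Definition phi (t : 'I_l -> int) (h : Mfs) : loc f := specialize t h * f_pow t.

Definition compatible_with_specialization
    (M : module_structure ({mpoly (diffop B)[l]}) Mfs) : Prop :=
  forall (t : 'I_l -> int) (d : {mpoly (diffop B)[l]}) (v : Mfs),
    phi t (M d v) = loc_op f (specialize t d) (phi t v).
End Specialization.

Section Extension.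
Variables (K : fieldType) (A T : comAlgType K) (iota : {lrmorphism A -> T}).

Definition extends (d' : diffop T) (d : diffop A) : Prop :=
  forall a, d' (iota a) = iota (d a).

Definition differentially_extensible : Prop :=
  forall d : diffop A, exists d' : diffop T, extends d' d.

Definition extends_coef l (d' : {mpoly (diffop T)[l]}) (d : {mpoly (diffop A)[l]}) : Prop :=
  forall m, extends d'@_m d@_m.

Record splitting := Splitting {
  split_fun :> T -> A;
  splitD : forall x y, split_fun (x + y) = split_fun x + split_fun y;
  splitM : forall a x, split_fun (iota a * x) = a * split_fun x;
  splitK : forall a, split_fun (iota a) = a
}.

Lemma restrict_subproof (beta : splitting) (d : diffop T) :
  `[< is_diffop (in_alg A) (fun a => beta (d (iota a))) >].
Proof.
have [dD dK [n dn]] := diffopP d.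
apply/asboolP; split.
- by move=> x y; rewrite rmorphD dD splitD.
- move=> k x; rewrite rmorphM /= rmorph_alg.
  by rewrite -[X in X * iota x]/(in_alg T k) dK /= -[k%:A](rmorph_alg iota) splitM.
exists n; elim: n (d : T -> T) {dK} dD dn => [|n IH] g gD gn b.
  by move=> x; rewrite rmorphM gn splitM.
have := IH (bracket g (iota b)) _ (gn (iota b)).
have gB x y : bracket g (iota b) (x + y)
    = bracket g (iota b) x + bracket g (iota b) y.
  by rewrite /bracket mulrDr !gD; ring.
move=> /(_ gB); apply: diffop_order_ext => x.
have sB u v : beta (u - v) = beta u - beta v.
  by apply: (addIr (beta v)); rewrite -splitD !subrK.
by rewrite /bracket sB splitM -rmorphM.
Qed.

Definition restrict (beta : splitting) (d : diffop T) : diffop A :=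
  DiffOp (restrict_subproof beta d).

(* M and N are modules with underlying groups V and W, and j plays the role of
   the inclusion of M in N. A-linearity refers to the scalar actions of
   A, which sits in D_A[s] and, through T, in D_T[s] as multiplication operators. *)
Section Summand.
Variables (beta : splitting) (l : nat) (V W : zmodType).
Variables (M : module_structure ({mpoly (diffop A)[l]}) V).
Variables (N : module_structure ({mpoly (diffop T)[l]}) W).
Variable j : V -> W.

Definition scaleV (a : A) (v : V) : V := M (mul_op a)%:MP v.
Definition scaleW (a : A) (w : W) : W := N (mul_op (iota a))%:MP w.

Definition is_A_submodule : Prop :=
  [/\ injective j, forall v v', j (v + v') = j v + j v'
    & forall a v, j (scaleV a v) = scaleW a (j v)].

Definition is_A_splitting (Theta : W -> V) : Prop :=
  [/\ forall w w', Theta (w + w') = Theta w + Theta w',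
      forall a w, Theta (scaleW a w) = scaleV a (Theta w)
    & forall v, Theta (j v) = v].

Definition differential_direct_summand : Prop :=
  is_A_submodule /\
  exists2 Theta : W -> V, is_A_splitting Theta &
    forall (d : {mpoly (diffop T)[l]}) v,
      Theta (N d (j v)) = M (map_coef (restrict beta) d) v.

Definition differentially_extensible_summand : Prop :=
  differential_direct_summand /\
  forall (d : {mpoly (diffop A)[l]}) (d' : {mpoly (diffop T)[l]}),
    extends_coef d' d -> forall v, N d' (j v) = j (M d v).
End Summand.

(* The inclusion of M^A[f^s] in M^T[f^s], induced by A_f -> T_f. *)
Definition Mfs_incl l (fs : 'I_l -> A) : Mfs fs -> Mfs (fun i => iota (fs i)) :=
  map_coef (loc_map iota (\prod_(i < l) iota (fs i))).
End Extension.

(* Main.v *)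
(* Every identity to be proved can be tested after all specializations phi_t:
   t |-> t^m are distinct characters of the monoid Z^l, hence linearly
   independent over the torsion-free group B_f (Dedekind), and f^t is a unit.
   The splitting Theta is the localization A_f <- T_f of beta applied to the
   coefficients, and phi_t commutes with the inclusion and with Theta. This
   reduces the claims to identities between differential operators on A_f with
   values in T_f or A_f, and such operators agree as soon as they agree on A. *)
Require Import Defs.
From HB Require Import structures.
From mathcomp Require Import all_boot all_algebra.
From mathcomp Require Import ring finmap boolp.
From mathcomp.multinomials Require Import monalg.
(* all_algebra shadows the fractions of Defs. *)
Import Defs.

Set Implicit Arguments.
Unset Strict Implicit.
Unset Printing Implicit Defensive.

Import GRing.Theory Num.Theory.

Local Open Scope ring_scope.

(** * Linear independence of integer-valued characters *)

Lemma character_independence (X : Type) (mulX : X -> X -> X) (oneX : X)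
    (I : eqType) (chi : I -> X -> int) (G : zmodType) :
  (forall i x y, chi i (mulX x y) = chi i x * chi i y) ->
  (forall i, chi i oneX = 1) ->
  (forall i j, i != j -> exists x, chi i x != chi j x) ->
  (forall (c : G) z, c *~ z = 0 -> z != 0 -> c = 0) ->
  forall (s : seq I) (c : I -> G), uniq s ->
  (forall x, \sum_(i <- s) c i *~ chi i x = 0) -> {in s, forall i, c i = 0}.
Proof.
move=> chiM chi1 chi_sep G_tf; elim=> [//|i0 s IH] c /andP[i0s us] c_rel.
have c_tail j : j \in s -> c j = 0.
  move=> js; have [u uP] : exists u, chi j u != chi i0 u.
    by apply: chi_sep; apply: contraNneq i0s => <-.
  (* The relation at [mulX x u] minus [chi i0 u] times the relation at [x] has no [i0] term;
     torsion-freeness then cancels the nonzero factor [chi j u - chi i0 u]. *)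
  have := IH (fun i => c i *~ (chi i u - chi i0 u)) us _ j js.
  move=> /(_ _)/G_tf -> //; last by rewrite subr_eq0.
  move=> x; have := c_rel (mulX x u); have := c_rel x.
  rewrite !big_cons => /(congr1 (fun y => y *~ chi i0 u)).
  rewrite mul0rz mulrzDl -mulrzA -chiM => e1 e2.
  transitivity (\sum_(i <- s) c i *~ chi i (mulX x u)
      - (\sum_(i <- s) c i *~ chi i x) *~ chi i0 u).
    rewrite mulrz_suml -sumrB; apply: eq_bigr => i _.
    by rewrite chiM -!mulrzA -mulrzBr; congr (_ *~ _); ring.
  apply/eqP; rewrite subr_eq0 -(inj_eq (addrI (c i0 *~ chi i0 (mulX x u)))).
  by rewrite e1 e2.
move=> i; rewrite inE => /predU1P[-> | /c_tail //].
have := c_rel oneX; rewrite big_cons big_seq big1 ?addr0 ?chi1 ?mulr1z //.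
by move=> j js; rewrite c_tail // mul0rz.
Qed.

Lemma zmod_morphism0 (G H : zmodType) (g : G -> H) : zmod_morphism g -> g 0 = 0.
Proof. by move=> gB; rewrite -(subrr 0) gB subrr. Qed.

Lemma zmod_morphismD (G H : zmodType) (g : G -> H) :
  zmod_morphism g -> forall x y, g (x + y) = g x + g y.
Proof.
move=> gB x y; have gN z : g (- z) = - g z.
  by rewrite -sub0r gB (zmod_morphism0 gB) sub0r.
by rewrite -{1}[y]opprK gB gN opprK.
Qed.

(** * Specialization of polynomials at integer points *)

Section Specialize.
Variable l : nat.
Implicit Types (G H : zmodType) (t : 'I_l -> int).

(** Summing over a set larger than the support allows termwise comparison of polynomials with
    different supports. *)
Lemma specializeEw G t (d : {fset 'X_{1..l}}) (h : {mpoly G[l]}) :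
  (msupp h `<=` d)%fset ->
  specialize t h = \sum_(m <- d) h@_m *~ (\prod_(i < l) t i ^+ m i).
Proof.
move=> le; rewrite /specialize; apply: big_fset_incl => // m _.
by move=> /mcoeff_outdom ->; rewrite mul0rz.
Qed.

Lemma specializeB G t (h1 h2 : {mpoly G[l]}) :
  specialize t (h1 - h2) = specialize t h1 - specialize t h2.
Proof.
rewrite (specializeEw t (msuppB_le h1 h2)).
rewrite (specializeEw t (fsubsetUl (msupp h1) (msupp h2))).
rewrite (specializeEw t (fsubsetUr (msupp h1) (msupp h2))) -sumrB.
by apply: eq_bigr => m _; rewrite mcoeffB mulrzBl.
Qed.

Lemma map_coefD G H (g : G -> H) : zmod_morphism g ->
  forall h1 h2 : {mpoly G[l]},
    map_coef g (h1 + h2) = map_coef g h1 + map_coef g h2.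
Proof.
move=> gB h1 h2; have g0 := zmod_morphism0 gB.
apply/malgP => m; rewrite [RHS]mcoeffD !map_coefE // mcoeffD.
exact: zmod_morphismD.
Qed.

(** [G] and [H] are only groups, so that [g] can be a localized map, [restrict beta], or the
    evaluation of operators at a point. *)
Lemma specialize_map_coef G H (g : G -> H) t (h : {mpoly G[l]}) :
  zmod_morphism g -> specialize t (map_coef g h) = g (specialize t h).
Proof.
move=> gB; pose g' : {additive G -> H} :=
  HB.pack g (GRing.isZmodMorphism.Build G H g gB).
have g0 := zmod_morphism0 gB.
have le : (msupp (map_coef g h) `<=` msupp h)%fset.
  apply/fsubsetP => m; rewrite -!mcoeff_neq0 map_coefE //.
  by apply: contra_neq => ->.
rewrite (specializeEw t le) -[g _]/(g' _) raddf_sum.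
by apply: eq_bigr => m _; rewrite map_coefE // raddfMz.
Qed.

Lemma specializeC (R : nzRingType) t (c : R) :
  specialize t (c%:MP : {mpoly R[l]}) = c.
Proof.
rewrite (specializeEw t (msuppC_le c)) big_seq_fset1 mcoeffC eqxx big1 ?mulr1z //.
by move=> i _; rewrite cm1 expr0.
Qed.

Lemma specialize_eq0 G (h : {mpoly G[l]}) :
  (forall (c : G) z, c *~ z = 0 -> z != 0 -> c = 0) ->
  (forall t, specialize t h = 0) -> h = 0.
Proof.
move=> G_tf h0; apply/malgP => m; rewrite mcoeff0.
have [mh|/mcoeff_outdom //] := boolP (m \in msupp h).
apply: (@character_independence ('I_l -> int) (fun t u i => t i * u i)
  (fun=> 1) 'X_{1..l} (fun m t => \prod_(i < l) t i ^+ m i) G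
  _ _ _ G_tf (msupp h) (fun m => h@_m) (fset_uniq _) h0 m mh).
- by move=> p t u; rewrite -big_split; apply: eq_bigr => i _; rewrite exprMn.
- by move=> p; rewrite big1 // => i _; rewrite expr1n.
move=> p q; apply: contra_neqP => sep; apply/eqP/cmP => i.
(* With 2 in coordinate [i] and 1 elsewhere, the monomial m takes the value 2^(m i), which
   determines its exponent at [i]. *)
pose t (j : 'I_l) : int := if j == i then 2 else 1.
have tE r : \prod_(j < l) t j ^+ r j = 2 ^+ r i.
  rewrite (bigD1 i) //= big1 ?mulr1 /t ?eqxx // => j /negPf ->.
  by rewrite expr1n.
have /eqP : \prod_(j < l) t j ^+ p j == \prod_(j < l) t j ^+ q j.
  by apply: contra_notT sep; exists t.
by rewrite !tE => /(@ieexprIn _ 2) ->.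
Qed.

End Specialize.

(** * Localization of maps that intertwine [f] and [g] *)

Section LocMap.
Variables (R S : comPzRingType) (f : R) (g : S) (h : R -> S).
Hypothesis hf : forall x, h (f * x) = g * h x.

Lemma semilinearX k x : h (x * f ^+ k) = h x * g ^+ k.
Proof.
elim: k => [|k IH]; rewrite ?expr0 ?mulr1 // exprS mulrCA hf IH exprS.
by rewrite mulrCA.
Qed.

(** Intertwining suffices for independence of the representative; this covers both the ring morphism
    [iota] and the splitting [beta], which is only [A]-linear. *)
Lemma loc_map_frac a n : loc_map h g (frac f a n) = frac g (h a) n.
Proof.
apply/fracP; have [k ek] := num_den f a n; exists k.
by rewrite -!semilinearX ![g ^+ k * _]mulrC -!semilinearX
  ![_ * f ^+ k]mulrC ek.
Qed.

Lemma loc_mapB :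
  zmod_morphism h -> zmod_morphism (loc_map h g : loc f -> loc g).
Proof.
move=> hB; have h0 := zmod_morphism0 hB.
have hN x : h (- x) = - h x by rewrite -sub0r hB h0 sub0r.
elim/loc_ind=> a n; elim/loc_ind=> b m.
have oppE (Q : comPzRingType) (q x : Q) k : - frac q x k = frac q (- x) k.
  exact: loc_oppE.
rewrite oppE fracD !loc_map_frac oppE -hN fracD -!semilinearX.
by rewrite -[- b * _]opprK hB -hN !opprK.
Qed.
End LocMap.

Section LocMapMorphism.
Variables (R S : comPzRingType) (f : R) (g : S) (h : {rmorphism R -> S}).
Hypothesis hfg : h f = g.

(** Having [h f = g] as an equation lets [g] be the product of the images of the f_i, at which [Mfs]
    over [T] is localized. *)
Lemma rmorph_mul_eq x : h (f * x) = g * h x.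
Proof. by rewrite rmorphM hfg. Qed.

Lemma loc_map_of a : loc_map h g (loc_of f a) = loc_of g (h a).
Proof. exact: loc_map_frac rmorph_mul_eq a 0. Qed.

Lemma loc_map_monoid_morphism :
  monoid_morphism (loc_map h g : loc f -> loc g).
Proof.
have hf := rmorph_mul_eq.
split; first by rewrite [1]/(frac f 1 0) loc_map_frac // rmorph1.
elim/loc_ind=> a n; elim/loc_ind=> b m.
by rewrite fracM !loc_map_frac // fracM rmorphM.
Qed.

End LocMapMorphism.

(** * Differential operators along a ring map *)

Section RelativeOrder.

(* P has order at most n as a differential operator from R to S, viewed as an
   R-module through sigma. *)
Fixpoint rel_order (R S : comPzRingType) (sigma : R -> S) n (P : R -> S) : Prop :=
  if n is n'.+1 then
    forall b, rel_order sigma n' (fun x => P (b * x) - sigma b * P x)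
  else forall b x, P (b * x) = sigma b * P x.

(** The semilinearity of [tau] turns the bracket of [d] with [sigma b] into the relative bracket
    with [b]. Identity maps for [sigma] or [tau] give composition on one side only. *)
Lemma rel_order_comp (R S S' : comPzRingType) (sigma : R -> S) (sigma' : R -> S')
    (tau : S -> S') n (d : S -> S) :
  (forall x y, sigma (x * y) = sigma x * sigma y) -> zmod_morphism tau ->
  (forall x y, tau (sigma x * y) = sigma' x * tau y) ->
  diffop_order n d -> rel_order sigma' n (fun x => tau (d (sigma x))).
Proof.
move=> sM tB tM; elim: n d => [|n IH] d dn b.
  by move=> x; rewrite sM dn tM.
have := IH _ (dn (sigma b)); congr (rel_order _ _ _).
by apply: funext => x; rewrite /bracket tB tM -sM.
Qed.

(** By induction on the order, the brackets of [P] and [Q] with elements of [R] agree everywhere: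
    they vanish at order 0, and otherwise have lower order and agree on [R]. Then [step] recovers
    [P =1 Q]. *)
Lemma rel_order_loc_uniq (R S : comPzRingType) (f : R) (sigma : loc f -> S)
    n (P Q : loc f -> S) :
  monoid_morphism sigma -> rel_order sigma n P -> rel_order sigma n Q ->
  (forall a, P (loc_of f a) = Q (loc_of f a)) -> P =1 Q.
Proof.
move=> [s1 sM].
suff step P' Q' : (forall b x, P' (loc_of f b * x) - sigma (loc_of f b) * P' x
      = Q' (loc_of f b * x) - sigma (loc_of f b) * Q' x) ->
    (forall a, P' (loc_of f a) = Q' (loc_of f a)) -> P' =1 Q'.
  elim: n P Q => [|n IH] P Q hP hQ eq_PQ; apply: step => // b.
    by move=> x; rewrite hP hQ !subrr.
  by apply: (IH _ _ (hP _) (hQ _)) => a; rewrite -rmorphM !eq_PQ.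
move=> eq_br eq_PQ x.
(* This power of [f] clears the denominator of [x], so the first terms of the brackets are equal
   values on [R]; its image under [sigma] is then cancelled by that of its inverse. *)
have := eq_br (f ^+ den x) x; rewrite loc_of_unit eq_PQ.
move=> /addrI/oppr_inj/(congr1 (fun y => sigma (frac f 1 (den x)) * y)).
rewrite !mulrA -sM /loc_of fracM mul1r addn0.
by have := frac_cancel f 1 (den x); rewrite mulr1 => ->; rewrite s1 !mul1r.
Qed.
End RelativeOrder.

(** * Extension and restriction of localized operators *)

Section Operators.
Variables (K : fieldType) (A T : comAlgType K) (iota : {lrmorphism A -> T}).
Variables (f : A) (g : T).
Hypothesis fg : iota f = g.
Local Notation lam := (loc_map iota g : loc f -> loc g).

(** Both sides are operators of finite order along [lam], and [extends] is their agreement on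
    [A]. *)
Lemma loc_op_extends (d' : diffop T) (d : diffop A) : extends iota d' d ->
  forall x, loc_op g d' (lam x) = lam (loc_op f d x).
Proof.
move=> dd'.
have [[_ _ [n' dn']] dE'] := loc_opP g d'; have [[_ _ [n dn]] dE] := loc_opP f d.
have lM := loc_map_monoid_morphism fg.
have lB := loc_mapB (rmorph_mul_eq fg) (raddfB iota).
apply: (@rel_order_loc_uniq _ _ f lam (maxn n n')) => //.
- apply: (@rel_order_comp _ _ _ lam lam id) => //; first by case: lM.
  exact: diffop_orderW (leq_maxr _ _) dn'.
- apply: (@rel_order_comp _ _ _ id lam lam) => //; first by case: lM.
  exact: diffop_orderW (leq_maxl _ _) dn.
by move=> a; rewrite dE !(loc_map_of fg) dE' dd'.
Qed.

Variable beta : splitting iota.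
Local Notation rho := (loc_map beta f : loc g -> loc f).

Lemma splittingB : zmod_morphism beta.
Proof. by move=> x y; apply: (addIr (beta y)); rewrite -splitD !subrK. Qed.

Lemma split_mul_eq x : beta (g * x) = f * beta x.
Proof. by rewrite -fg splitM. Qed.

Lemma loc_splitM x y : rho (lam x * y) = x * rho y.
Proof.
have bM := split_mul_eq; have iM := rmorph_mul_eq fg.
elim/loc_ind: x => a n; elim/loc_ind: y => t m.
by rewrite loc_map_frac // fracM !loc_map_frac // splitM fracM.
Qed.

Lemma loc_splitK x : rho (lam x) = x.
Proof.
have bM := split_mul_eq; have iM := rmorph_mul_eq fg.
by elim/loc_ind: x => a n; rewrite !loc_map_frac // splitK.
Qed.

(** Since [rho] is linear over A_f, the left side is an operator on A_f; on [A] it is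
    [restrict beta d] by definition. *)
Lemma loc_op_restrict (d : diffop T) x :
  rho (loc_op g d (lam x)) = loc_op f (restrict beta d) x.
Proof.
move: x; have bM := split_mul_eq.
have [[_ _ [n' dn']] dE'] := loc_opP g d.
have [[_ _ [n dn]] dE] := loc_opP f (restrict beta d).
have [_ lM] := loc_map_monoid_morphism fg.
have rB := loc_mapB bM splittingB.
apply: (@rel_order_loc_uniq _ _ f id (maxn n n')) => //.
- apply: (@rel_order_comp _ _ _ lam id rho) => //; first exact: loc_splitM.
  exact: diffop_orderW (leq_maxr _ _) dn'.
- apply: (@rel_order_comp _ _ _ id id id) => //.
  exact: diffop_orderW (leq_maxl _ _) dn.
by move=> a; rewrite dE (loc_map_of fg) dE' /loc_of loc_map_frac.
Qed.
End Operators.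

Lemma loc_op_mul (K : fieldType) (B : comAlgType K) (f b : B) x :
  loc_op f (mul_op b) x = loc_of f b * x.
Proof.
have [[mD _ mo] mE] := loc_opP f (mul_op b); move: x.
apply: loc_op_uniq => //; first exact: fin_order_mul.
by move=> a; rewrite mE rmorphM.
Qed.

(** * Specializations separate the elements of M^B[f^s] *)

Section Phi.
Variables (K : fieldType) (B : comAlgType K) (l : nat) (fs : 'I_l -> B).
Local Notation f := (\prod_(i < l) fs i).

(** Characteristic zero makes [z] invertible in [K], and the inverse acts on B_f; this supplies the
    torsion-freeness for [specialize_eq0]. *)
Lemma loc_mulrz_eq0 (charK : [pchar K] =i pred0) (x : loc f) z :
  x *~ z = 0 -> z != 0 -> x = 0.
Proof.
move=> xz z0; have z0K : z%:~R != 0 :> K.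
  have /pcharf0P cK := charK.
  by case: z z0 {xz} => n; rewrite ?NegzE ?mulrNz ?oppr_eq0 -?pmulrn cK.
have -> : x = loc_of f (in_alg B z%:~R^-1) * (x *~ z).
  rewrite mulrzAr -mulrzAl -[_ *~ _](rmorphMz (loc_of f)) -rmorphMz.
  by rewrite -mulrzl divff // !rmorph1 mul1r.
by rewrite xz mulr0.
Qed.

Lemma f_pow_unit t : exists u, u * f_pow fs t = 1.
Proof.
(* This is f^(-t): the f_i and their inverses are exchanged. *)
exists (\prod_(i < l) match t i with
  | Posz n => loc_inv fs i ^+ n | Negz n => loc_of f (fs i) ^+ n.+1 end).
rewrite /f_pow -big_split /=; apply: big1 => i _.
by case: (t i) => n; rewrite -exprMn 1?[loc_inv _ _ * _]mulrC loc_invP expr1n.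
Qed.

Lemma phi_separated (charK : [pchar K] =i pred0) (v w : Mfs fs) :
  (forall t, phi t v = phi t w) -> v = w.
Proof.
move=> e; apply/eqP; rewrite -subr_eq0; apply/eqP.
apply: specialize_eq0 (loc_mulrz_eq0 charK) _ => t; rewrite specializeB.
have [u fu] := f_pow_unit t; apply/eqP; rewrite subr_eq0; apply/eqP.
have := congr1 (fun y => y * u) (e t).
by rewrite /phi -!mulrA [f_pow _ _ * u]mulrC fu !mulr1.
Qed.

(** Scalars act through constant polynomials, whose specialization does not depend on [t]. *)
Lemma phi_scale (M : module_structure {mpoly (diffop B)[l]} (Mfs fs)) t b v :
  compatible_with_specialization M ->
  phi t (M (mul_op b)%:MP v) = loc_of f b * phi t v.
Proof. by move=> ->; rewrite specializeC loc_op_mul. Qed.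
End Phi.

(** * The inclusion and the splitting under specialization *)

Section Inclusion.
Variables (K : fieldType) (A T : comAlgType K) (iota : {lrmorphism A -> T}).
Variables (l : nat) (fs : 'I_l -> A).
Local Notation f := (\prod_(i < l) fs i).
Local Notation gs := (fun i => iota (fs i)).
Local Notation g := (\prod_(i < l) iota (fs i)).
Local Notation lam := (loc_map iota g : loc f -> loc g).

Lemma iota_prod : iota f = g.
Proof. exact: rmorph_prod. Qed.

Lemma iota_locB : zmod_morphism lam.
Proof. exact: loc_mapB (rmorph_mul_eq iota_prod) (raddfB iota). Qed.

Lemma f_pow_incl t : lam (f_pow fs t) = f_pow gs t.
Proof.
have [l1 lM] := loc_map_monoid_morphism iota_prod.
have lX x n : lam (x ^+ n) = lam x ^+ n.
  by elim: n => [|n IH]; rewrite ?expr0 // !exprS lM IH.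
rewrite /f_pow (big_morph _ lM l1); apply: eq_bigr => i _.
case: (t i) => n; rewrite lX /loc_of /loc_inv loc_map_frac ?rmorph_prod //;
  exact: rmorph_mul_eq iota_prod.
Qed.

Lemma phi_incl t (v : Mfs fs) : phi t (Mfs_incl iota v) = lam (phi t v).
Proof.
have [_ lM] := loc_map_monoid_morphism iota_prod.
by rewrite /phi specialize_map_coef ?lM ?f_pow_incl //; apply: iota_locB.
Qed.

Variable beta : splitting iota.
Local Notation rho := (loc_map beta f : loc g -> loc f).

Lemma split_locB : zmod_morphism rho.
Proof. exact: loc_mapB (split_mul_eq iota_prod beta) (splittingB beta). Qed.

Definition Mfs_split : Mfs gs -> Mfs fs := map_coef rho.

Lemma phi_split t (w : Mfs gs) : phi t (Mfs_split w) = rho (phi t w).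
Proof.
rewrite /phi specialize_map_coef; last exact: split_locB.
(* The factor f^t over [T] comes from A_f, so the A_f-linear [rho] lets it pass. *)
by rewrite -f_pow_incl [in RHS]mulrC (loc_splitM iota_prod) mulrC.
Qed.

End Inclusion.

(** * The two conditions of a differentially extensible summand *)

Theorem theorem3p22 (K : fieldType) (charK : [pchar K] =i pred0)
  (A T : comAlgType K) (noethA : noetherian A) (noethT : noetherian T)
  (iota : {lrmorphism A -> T}) (iota_inj : injective iota)
  (beta : splitting iota)
  (l : nat) (f : 'I_l -> A)
  (MA : module_structure {mpoly (diffop A)[l]} (Mfs f))
  (MT : module_structure {mpoly (diffop T)[l]} (Mfs (fun i => iota (f i))))
  (compatA : compatible_with_specialization MA)
  (compatT : compatible_with_specialization MT)
  (ext : differentially_extensible iota) :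
  differentially_extensible_summand beta MA MT (Mfs_incl iota (fs := f)).
Proof.
have eqA := phi_separated charK (fs := f).
have eqT := phi_separated charK (fs := fun i => iota (f i)).
have fg := iota_prod iota f; have lamB := iota_locB iota (fs := f).
have rhoB := split_locB beta (fs := f).
have [_ lamM] := loc_map_monoid_morphism fg.
have ThetaK v : Mfs_split beta (Mfs_incl iota (fs := f) v) = v.
  by apply: eqA => t; rewrite phi_split phi_incl (loc_splitK fg).
split; first split; first split.
- exact: can_inj ThetaK.
- exact: map_coefD lamB.
- move=> a v; apply: eqT => t.
  by rewrite phi_incl !phi_scale // phi_incl lamM (loc_map_of fg).
- exists (Mfs_split beta (fs := f)); first split.
  + exact: map_coefD rhoB.
  + move=> a w; apply: eqA => t.
    by rewrite phi_split !phi_scale // phi_split -(loc_map_of fg) (loc_splitM fg).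
  + exact: ThetaK.
  move=> d v; apply: eqA => t; rewrite phi_split compatT compatA phi_incl.
  (* Restriction along [beta] is additive, hence commutes with specialization of the
     coefficients. *)
  rewrite (loc_op_restrict fg) specialize_map_coef // => d1 d2.
  by apply: diffop_ext => x /=; rewrite splittingB.
move=> d d' dd' v; apply: eqT => t; rewrite compatT !phi_incl compatA.
apply: (loc_op_extends fg) => a.
(* It remains that the specialization of [d'] extends that of [d]. Evaluation at a fixed [a] is
   additive in the operator, which reduces this to the coefficients. *)
pose evT (e : diffop T) : T := e (iota a).
pose evA (e : diffop A) : T := iota (e a).
have evTB : zmod_morphism evT by [].
have evAB : zmod_morphism evA by move=> e1 e2; rewrite /evA /= rmorphB.
rewrite -[LHS]/(evT _) -[RHS]/(evA _) -!specialize_map_coef //.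
congr (specialize t _); apply/malgP => m.
by rewrite !map_coefE ?zmod_morphism0 //; apply: dd'.
Qed.
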